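(* Let $(A,\mathfrak m)$ be a Noetherian local ring with $\dim A>0$ and let $I$ be a regular ideal of $A$. Then $$s(I)\le \max\{\operatorname{reg} R(I)-1,\,0\}.$$
   Context: An ideal $I$ is regular if it contains a non-zerodivisor of $A$. The Ratliff-Rush closure of $I$ is $\tilde I:=\bigcup_{n\ge 1}(I^{n+1}:I^n)$ (with $I^0=A$). $s(I)$ denotes the least integer $m\ge 0$ such that $I^{n+1}:I^n=\tilde I$ for all $n\ge m$. $R(I)=\bigoplus_{n\ge 0}I^n$ is the Rees algebra, a standard graded algebra over $A$. For a standard graded algebra $R$ over a commutative ring, let $R_+$ be the ideal generated by the elements of positive degree, let $H^i_{R_+}(R)$ be the $i$-th local cohomology module, put $a_i(R)=\max\{n\mid H^i_{R_+}(R)_n\ne 0\}$ (with $a_i(R)=-\infty$ if $H^i_{R_+}(R)=0$), and define the Castelnuovo-Mumford regularity $\operatorname{reg}R=\max\{a_i(R)+i\mid i\ge 0\}$. *)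

(* Defs.v *)
From HB Require Import structures.
From mathcomp Require Import all_boot all_order all_algebra.
From mathcomp Require Import all_classical constructive_ereal.

Set Implicit Arguments.
Unset Strict Implicit.
Unset Printing Implicit Defensive.
Import Order.TTheory GRing.Theory Num.Theory.
Local Open Scope classical_set_scope.
Local Open Scope ring_scope.

(** * Suprema in the extended integers *)

Definition ext_sup (S : set (\bar int)) : \bar int := supremum -oo%E S.

Lemma ext_supP (S : set (\bar int)) :
  (forall x, S x -> (x <= ext_sup S)%E) /\
  (forall y, (forall x, S x -> (x <= y)%E) -> (ext_sup S <= y)%E).
Proof.
suff [z [hz1 hz2]] : exists z, supremums S z.
  rewrite /ext_sup /supremum; case: ifPn => [/eqP ->|_].
    by split => // y _; rewrite leNye.
  case: xgetP => [w _ [h1 h2]|/(_ z) []]; last by split.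
  by split => // y hy; apply: h2.
case: (pselect (S +oo%E)) => [Sy|nSy].
  by exists +oo%E; split => [x _|y /(_ _ Sy)]; rewrite ?leey.
case: (pselect (exists k, S k%:E)) => [[k Sk]|nk]; last first.
  exists -oo%E; split => [[k|//|] Sx|y _]; rewrite ?leNye //.
  by case: nk; exists k.
case: (pselect (exists b : nat, forall l : int, S l%:E -> l <= k + b%:Z)) => [hb|nb].
  have hb' : exists b : nat, `[< forall l : int, S l%:E -> l <= k + b%:Z >].
    by case: hb => b /asboolP; exists b.
  case: (ex_minnP hb') => b /asboolP hmax hmin.
  exists (k + b%:Z)%:E; split.
    by move=> [l|//|] Sx; rewrite ?leNye // lee_fin; apply: hmax.
  suff Sb : S (k + b%:Z)%:E by move=> y /(_ _ Sb).
  case: b hmax hmin => [|b] hmax hmin; first by rewrite addr0.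
  apply: contrapT => nS.
  have : (b.+1 <= b)%N; last by rewrite ltnn.
  apply: hmin; apply/asboolP => l Sl.
  have := hmax l Sl; rewrite le_eqVlt => /predU1P[E|].
    by rewrite E in Sl.
  by rewrite -[b.+1]addn1 PoszD addrA ltzD1.
exists +oo%E; split => [x _|y hy]; first by rewrite leey.
case: y hy => [y|//|] hy; last by have := hy _ Sk.
case: nb; exists `|y - k|%N => l Sl.
have := hy _ Sl; rewrite lee_fin => /le_trans; apply.
by rewrite -lerBlDl; apply: ler_norm.
Qed.

(** * Ideals of a commutative ring *)

(* Ideals are [Prop]-valued sets and may be the whole ring; the [idealr]
   structures of MathComp's ring_quotient only cover proper ideals. *)
Definition is_ideal (A : comNzRingType) (I : set A) : Prop :=
  [/\ I 0, (forall x y, I x -> I y -> I (x + y))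
    & (forall a x, I x -> I (a * x))].

Definition ideal_mul (A : comNzRingType) (I J : set A) : set A :=
  [set x | exists2 s : seq (A * A),
     (forall p, p \in s -> I p.1 /\ J p.2) & x = \sum_(p <- s) p.1 * p.2].

Definition ideal_gen (A : comNzRingType) (S : set A) : set A :=
  ideal_mul [set: A] S.

Fixpoint ideal_pow (A : comNzRingType) (I : set A) (n : nat) : set A :=
  if n is k.+1 then ideal_mul I (ideal_pow I k) else [set: A].

Definition colon (A : comNzRingType) (J K : set A) : set A :=
  [set a | forall x, K x -> J (a * x)].

Definition prime_ideal (A : comNzRingType) (P : set A) : Prop :=
  [/\ is_ideal P, ~ P 1 & forall x y, P (x * y) -> P x \/ P y].

Definition maximal_ideal (A : comNzRingType) (M : set A) : Prop :=
  [/\ is_ideal M, ~ M 1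
    & forall J : set A, is_ideal J -> M `<=` J -> ~ J 1 -> J = M].

Definition local_ring (A : comNzRingType) (m : set A) : Prop :=
  maximal_ideal m /\ forall M : set A, maximal_ideal M -> M = m.

Definition noetherian (A : comNzRingType) : Prop :=
  forall I : set A, is_ideal I -> exists s : seq A, I = ideal_gen [set` s].

Definition prime_chain (A : comNzRingType) (n : nat) (p : nat -> set A) : Prop :=
  (forall i, (i <= n)%N -> prime_ideal (p i)) /\
  (forall i, (i < n)%N -> p i `<` p i.+1).

Definition krull_dim (A : comNzRingType) : \bar int :=
  ext_sup [set (n%:Z)%:E | n in [set n | exists p, @prime_chain A n p]].

Definition regular_ideal (A : comNzRingType) (I : set A) : Prop :=
  exists2 x, I x & GRing.lreg x.

Section IdealFacts.
Variable A : comNzRingType.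
Implicit Types I J K : set A.

Lemma ideal_sum I (T : eqType) (s : seq T) (f : T -> A) :
  is_ideal I -> (forall i, i \in s -> I (f i)) -> I (\sum_(i <- s) f i).
Proof.
move=> [I0 ID _] h; rewrite big_seq; apply: (big_ind I) => // i; exact: h.
Qed.

Lemma idealN I x : is_ideal I -> I x -> I (- x).
Proof. by move=> [_ _ IM] Ix; rewrite -mulN1r; apply: IM. Qed.

Lemma ideal_mul_ideal I J : is_ideal J -> is_ideal (ideal_mul I J).
Proof.
move=> [J0 JD JM]; split.
- by exists [::] => //; rewrite big_nil.
- move=> x y [s hs ->] [t ht ->]; exists (s ++ t); last by rewrite big_cat.
  by move=> p; rewrite mem_cat => /orP[/hs|/ht].
- move=> a x [s hs ->]; exists [seq (p.1, a * p.2) | p <- s].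
    by move=> _ /mapP[p /hs[Ip Jp] ->]; split=> //; apply: JM.
  rewrite big_map mulr_sumr; apply: eq_bigr => p _ /=; exact: mulrCA.
Qed.

Lemma ideal_mul_mem I J x y : I x -> J y -> ideal_mul I J (x * y).
Proof.
move=> Ix Jy; exists [:: (x, y)]; last by rewrite big_seq1.
by move=> p; rewrite inE => /eqP ->.
Qed.

Lemma ideal_mul_sub I J K : is_ideal K ->
  (forall x y, I x -> J y -> K (x * y)) -> ideal_mul I J `<=` K.
Proof.
move=> hK h x [s hs ->]; apply: ideal_sum => // p /hs[]; exact: h.
Qed.

Lemma ideal_pow_ideal I n : is_ideal (ideal_pow I n).
Proof. by elim: n => [|n IH] /=; [split|exact: ideal_mul_ideal]. Qed.

Lemma ideal_powD I i j x y :
  ideal_pow I i x -> ideal_pow I j y -> ideal_pow I (i + j) (x * y).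
Proof.
elim: i x => [|i IH] x /=.
  by move=> _; case: (ideal_pow_ideal I j) => _ _; apply.
move=> [s hs ->] Jy; rewrite mulr_suml; apply: ideal_sum.
  exact: (ideal_pow_ideal I (i + j).+1).
by move=> p /hs[Ip Jp]; rewrite -mulrA; apply: ideal_mul_mem => //; apply: IH.
Qed.

End IdealFacts.

(** * Ratliff-Rush closure *)

Definition rr_closure (A : comNzRingType) (I : set A) : set A :=
  [set a | exists2 n, (1 <= n)%N &
     colon (ideal_pow I n.+1) (ideal_pow I n) a].

Definition rr_stable (A : comNzRingType) (I : set A) (m : nat) : Prop :=
  forall n, (m <= n)%N ->
    colon (ideal_pow I n.+1) (ideal_pow I n) = rr_closure I.

Section RatliffRush.
Variables (A : comNzRingType) (I : set A).
Let C n := colon (ideal_pow I n.+1) (ideal_pow I n).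

Lemma rr_colon_ideal n : is_ideal (C n).
Proof.
have [P0 PD PM] := ideal_pow_ideal I n.+1; split.
- by move=> x _; rewrite mul0r.
- by move=> x y hx hy z hz; rewrite mulrDl; apply: PD; [apply: hx|apply: hy].
- by move=> a x hx z hz; rewrite -mulrA; apply: PM; apply: hx.
Qed.

Lemma rr_colon_mono i j : (i <= j)%N -> C i `<=` C j.
Proof.
move=> /subnK <-; elim: (j - i)%N => // k IH a /IH hC.
move=> _ [s hs ->]; rewrite mulr_sumr; apply: ideal_sum.
  exact: (ideal_pow_ideal I (k + i).+2).
move=> p /hs[Ip Jp]; rewrite mulrCA; apply: ideal_mul_mem => //; exact: hC.
Qed.

Lemma rr_stable_exists : noetherian A -> exists m, `[< rr_stable I m >].
Proof.
move=> hA.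
have hrr : is_ideal (rr_closure I).
  split.
  - by exists 1%N => //; case: (rr_colon_ideal 1).
  - move=> x y [i i1 hi] [j j1 hj]; exists (maxn i j).
      by rewrite leq_max i1.
    case: (rr_colon_ideal (maxn i j)) => _ + _; apply.
      by apply: (rr_colon_mono (leq_maxl i j)).
    by apply: (rr_colon_mono (leq_maxr i j)).
  - move=> a x [i i1 hi]; exists i => //.
    by case: (rr_colon_ideal i) => _ _; apply.
have [s hs] := hA _ hrr.
have [m hm] : exists m, forall x, x \in s -> C m x.
  have : forall x, x \in s -> rr_closure I x.
    by move=> x xs; rewrite hs -[x]mul1r; apply: ideal_mul_mem.
  elim: (s) => [|x t IH] h; first by exists 0%N.
  have [|m hm] := IH; first by move=> y yt; apply: h; rewrite inE yt orbT.
  have [i _ hi] := h x (mem_head _ _).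
  exists (maxn m i) => y; rewrite inE => /predU1P[->|/hm].
    exact: (rr_colon_mono (leq_maxr m i)).
  exact: (rr_colon_mono (leq_maxl m i)).
exists m; apply/asboolP => n mn; apply/seteqP; split.
  move=> a ha; exists n.+1 => //; exact: (rr_colon_mono (leqnSn n)).
rewrite hs; apply: ideal_mul_sub; first exact: rr_colon_ideal.
move=> a x _ xs; case: (rr_colon_ideal n) => _ _; apply.
by apply: (rr_colon_mono mn); apply: hm.
Qed.

End RatliffRush.

Definition rr_index (A : comNzRingType) (hA : noetherian A) (I : set A) : nat :=
  ex_minn (rr_stable_exists I hA).

Lemma rr_indexP (A : comNzRingType) (hA : noetherian A) (I : set A) :
  rr_stable I (rr_index hA I) /\
  forall m, rr_stable I m -> (rr_index hA I <= m)%N.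
Proof.
rewrite /rr_index; case: ex_minnP => m /asboolP hm h; split => // k /asboolP.
exact: h.
Qed.

(** * Graded rings and graded modules *)

Definition add_subgroup (V : zmodType) (S : set V) : Prop :=
  S 0 /\ forall x y, S x -> S y -> S (x - y).

Definition internal_direct_sum (T : eqType) (V : zmodType) (V_ : T -> set V) :
    Prop :=
  (forall x, exists (s : seq T) (f : T -> V),
     [/\ uniq s, forall i, V_ i (f i) & x = \sum_(i <- s) f i]) /\
  (forall (s : seq T) (f : T -> V), uniq s -> (forall i, V_ i (f i)) ->
     \sum_(i <- s) f i = 0 -> forall i, i \in s -> f i = 0).

Record gradedRing := GradedRing {
  gr_ring :> comNzRingType;
  gr_comp : nat -> set gr_ring;
  gr_subgroup : forall n, add_subgroup (gr_comp n);
  gr_one : gr_comp 0%N 1;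
  gr_mul : forall i j x y,
    gr_comp i x -> gr_comp j y -> gr_comp (i + j)%N (x * y);
  gr_direct : internal_direct_sum gr_comp }.

Record gradedModule (R : gradedRing) := GradedModule {
  gm_mod :> lmodType R;
  gm_comp : int -> set gm_mod;
  gm_subgroup : forall n, add_subgroup (gm_comp n);
  gm_scale : forall (i : nat) (j : int) (r : R) (x : gm_mod),
    gr_comp i r -> gm_comp j x -> gm_comp (i%:Z + j) (r *: x);
  gm_direct : internal_direct_sum gm_comp }.

Record gradedHom (R : gradedRing) (M N : gradedModule R) := GradedHom {
  gh_fun :> {linear M -> N};
  gh_comp : forall n x, gm_comp n x -> gm_comp n (gh_fun x) }.

Section SelfModule.
Variable R : gradedRing.

Definition self_comp (n : int) : set R^o :=
  if n is Posz k then @gr_comp R k else [set 0].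

Lemma self_subgroup n : add_subgroup (self_comp n).
Proof.
case: n => n; first exact: gr_subgroup.
by split => // x y -> ->; rewrite /= subr0.
Qed.

Lemma self_scale (i : nat) (j : int) (r : R) (x : R^o) :
  gr_comp i r -> self_comp j x -> self_comp (i%:Z + j) (r *: x).
Proof.
case: j => j hr; first exact: gr_mul.
by move=> ->; rewrite scaler0; case: (self_subgroup (i%:Z + Negz j)).
Qed.

Lemma self_direct : internal_direct_sum self_comp.
Proof.
have [dec ind] := gr_direct R; split.
- move=> x; have [s [f [us hf ->]]] := dec x.
  exists [seq Posz k | k <- s], (fun n : int => if n is Posz k then f k else 0).
  split.
  + by rewrite map_inj_uniq // => a b [].
  + by case=> k //=; exact: hf.
  + by rewrite big_map.
- move=> s f us hf s0 i is_.
  have fN k : f (Negz k) = 0 by exact: (hf (Negz k)).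
  case: i is_ => k is_; last exact: fN.
  pose t := pmap (fun n : int => if n is Posz k then Some k else None) s.
  have tP n : (n \in t) = (Posz n \in s).
    rewrite mem_pmap; apply/mapP/idP => [[[] a // ha [->]] //|h].
    by exists (Posz n).
  have ut : uniq t.
    apply: (pmap_uniq (g := Posz)) us.
    by case=> n.
  apply: (ind t (fun n => f (Posz n)) ut) => //; last by rewrite tP.
    by move=> n; exact: (hf (Posz n)).
  rewrite -[RHS]s0 /t; elim: (s) => [|[] n u IH] /=.
  + by rewrite !big_nil.
  + by rewrite !big_cons IH.
  + by rewrite big_cons IH fN add0r.
Qed.

Definition self_gmod : gradedModule R :=
  GradedModule self_subgroup self_scale self_direct.

End SelfModule.

(** * Graded local cohomology and regularity *)

(* [R_+] *)
Definition irrelevant_ideal (R : gradedRing) : set R :=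
  ideal_gen [set x | exists2 n, (0 < n)%N & gr_comp n x].

(* The [R_+]-torsion functor, whose right derived functors are [H^i_{R_+}]. *)
Definition torsion (R : gradedRing) (M : gradedModule R) : set M :=
  [set x | exists k, forall r : R,
     ideal_pow (@irrelevant_ideal R) k r -> r *: x = 0].

Definition graded_injective (R : gradedRing) (E : gradedModule R) : Prop :=
  forall (M N : gradedModule R) (u : gradedHom M N) (f : gradedHom M E),
    injective u -> exists g : gradedHom N E, forall x, g (u x) = f x.

Record injResolution (R : gradedRing) (M : gradedModule R) := InjResolution {
  res_obj :> nat -> gradedModule R;
  res_aug : gradedHom M (res_obj 0%N);
  res_d : forall i, gradedHom (res_obj i) (res_obj i.+1);
  res_injective : forall i, graded_injective (res_obj i);
  res_aug_inj : injective res_aug;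
  res_exact0 : forall x, res_d 0%N x = 0 <-> exists y, x = res_aug y;
  res_exact : forall i x, res_d i.+1 x = 0 <-> exists y, x = res_d i y }.

Definition lc_cocycle (R : gradedRing) (M : gradedModule R)
    (E : injResolution M) (i : nat) (n : int) : set (E i) :=
  [set x | [/\ gm_comp n x, torsion x & res_d E i x = 0]].

Definition lc_coboundary (R : gradedRing) (M : gradedModule R)
    (E : injResolution M) (i : nat) (n : int) : set (E i) :=
  match i return set (E i) with
  | 0%N => [set 0]
  | j.+1 => [set x | exists y : E j,
                [/\ gm_comp n y, torsion y & x = res_d E j y]]
  end.

Arguments lc_cocycle {R M} E i n.
Arguments lc_coboundary {R M} E i n.

(* [H^i_{R_+}(M)_n <> 0]: the right derived functors of [torsion] on Z-graded
   modules are computed by any graded injective resolution of [M].  One exists,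
   as there are enough injectives, and the cohomology does not depend on it up
   to isomorphism, so "for every" and "for some" resolution mean the same. *)
Definition lc_nonzero (R : gradedRing) (M : gradedModule R) (i : nat) (n : int) :
    Prop :=
  forall E : injResolution M,
    ~ (lc_cocycle E i n `<=` lc_coboundary E i n).

(* The maxima are written as suprema in the extended integers ([ext_supP]): [-oo]
   on the empty set, the maximum of a nonempty set of integers bounded above. *)
Definition a_inv (R : gradedRing) (i : nat) : \bar int :=
  ext_sup [set n%:E | n in [set n | lc_nonzero (self_gmod R) i n]].

Definition reg (R : gradedRing) : \bar int :=
  ext_sup [set (a_inv R i + (i%:Z)%:E)%E | i in [set: nat]].

(** * Rees algebras *)

(* [R(I)] is realized as the subring of [A[t]] of the polynomials whose
   coefficient of [t^n] lies in [I^n] for all [n]. *)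
Definition rees_pred (A : comNzRingType) (I : set A) : {pred {poly A}} :=
  [pred p : {poly A} | `[< forall n, ideal_pow I n p`_n >]].

Section Rees.
Variables (A : comNzRingType) (I : set A).

Lemma rees_predP (p : {poly A}) :
  reflect (forall n, ideal_pow I n p`_n) (p \in rees_pred I).
Proof. exact: asboolP. Qed.

Lemma rees_subring_closed : subring_closed (rees_pred I).
Proof.
split.
- apply/rees_predP => -[|n] //; rewrite coef1.
  by case: (ideal_pow_ideal I n.+1).
- move=> p q /rees_predP hp /rees_predP hq; apply/rees_predP => n.
  rewrite coefB; case: (ideal_pow_ideal I n) => _ + _; apply => //.
  by apply: idealN => //; exact: ideal_pow_ideal.
- move=> p q /rees_predP hp /rees_predP hq; apply/rees_predP => n.
  rewrite coefM; apply: ideal_sum; first exact: ideal_pow_ideal.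
  move=> i _; rewrite -{1}(subnKC (_ : i <= n)%N); last by rewrite -ltnS.
  exact: ideal_powD.
Qed.

HB.instance Definition _ :=
  GRing.isSubringClosed.Build {poly A} (rees_pred I) rees_subring_closed.

Definition rees := {p : {poly A} | p \in rees_pred I}.
HB.instance Definition _ := SubType.on rees.
HB.instance Definition _ := Choice.on rees.
HB.instance Definition _ := [SubChoice_isSubComNzRing of rees by <:].

Definition rees_comp (n : nat) : set rees :=
  [set p : rees | forall i : nat, i != n -> (val p)`_i = 0].

Lemma rees_subgroup n : add_subgroup (rees_comp n).
Proof.
split=> [i _|x y hx hy i ni]; first by rewrite raddf0 coef0.
by rewrite raddfB coefB hx // hy // subr0.
Qed.

Lemma rees_one : rees_comp 0 1.
Proof. by move=> i /negPf i0; rewrite rmorph1 coef1 i0. Qed.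

Lemma rees_mul i j (x y : rees) :
  rees_comp i x -> rees_comp j y -> rees_comp (i + j) (x * y).
Proof.
move=> hx hy k kij; rewrite rmorphM coefM big1 // => l _.
have [li|/hx ->] := eqVneq (l : nat) i; last by rewrite mul0r.
rewrite hy ?mulr0 //; apply: contraNneq kij => <-.
by rewrite -li subnKC // -ltnS.
Qed.

Lemma rees_direct : internal_direct_sum rees_comp.
Proof.
split.
- move=> x.
  have hm n : (val x)`_n *: 'X^n \in rees_pred I.
    apply/rees_predP => k; rewrite coefZ coefXn.
    have [->|_] := eqVneq k n; first by rewrite mulr1; apply/rees_predP/valP.
    by rewrite mulr0; case: (ideal_pow_ideal I k).
  exists (iota 0 (size (val x))), (fun n => exist [in rees_pred I] _ (hm n) : rees); split.
  + exact: iota_uniq.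
  + by move=> n i /negPf ni; rewrite /= coefZ coefXn ni mulr0.
  + apply: val_inj; rewrite raddf_sum /= -[LHS]coefK poly_def.
    by have := big_mkord xpredT (fun i => (val x)`_i *: 'X^i) (n := size (val x)); rewrite /index_iota subn0 => ->.
- move=> s f us hf s0 i is_; apply: val_inj; rewrite raddf0.
  apply/polyP => k; rewrite coef0.
  have [->|/hf//] := eqVneq k i.
  have := congr1 (fun p : rees => (val p)`_i) s0.
  rewrite raddf0 coef0 raddf_sum coef_sum (bigD1_seq i) //= big1 ?addr0 //.
  by move=> j ji; rewrite (hf j i) // eq_sym.
Qed.

End Rees.

Definition rees_algebra (A : comNzRingType) (I : set A) : gradedRing :=
  @GradedRing (rees I) (@rees_comp A I) (@rees_subgroup A I) (@rees_one A I)
    (@rees_mul A I) (@rees_direct A I).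

(* Main.v *)
Require Import Defs.
From mathcomp Require Import all_boot all_order all_algebra.
From mathcomp Require Import all_classical constructive_ereal.
From HB Require Import structures.
Set Implicit Arguments.
Unset Strict Implicit.
Unset Printing Implicit Defensive.
Import Order.TTheory GRing.Theory Num.Theory.
Local Open Scope classical_set_scope.
Local Open Scope ring_scope.

(** Put [s = s(I)] and suppose [s > 0]; it suffices to find a nonzero class in
    [H^1_{R_+}(R(I))_s], for then [reg R(I) >= s + 1].

    Minimality of [s] yields [a] in the Ratliff-Rush closure and [b] in
    [I^(s-1)] with [c = a b] outside [I^s].  As [a I^n] lies in [I^(n+1)] as
    soon as [n >= s], the ideal [c I^n] is contained in [I^(s+n)] for every
    [n > 0] ([rr_index_witness]).  So [c t^s] is an element of [A[t]] outside
    [R(I)] that [R_+] multiplies into [R(I)]: a nonzero [R_+]-torsion element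
    of [A[t]/R(I)] in degree [s].  As [I] contains a nonzerodivisor [x] of [A],
    the element [x t] of [R_+] is a nonzerodivisor on [A[t]], which therefore
    has no [R_+]-torsion, and the connecting map
    [H^0_{R_+}(A[t]/R(I)) -> H^1_{R_+}(R(I))] is injective.

    Local cohomology is given through an arbitrary injective resolution
    [R(I) -> E0 -> E1 -> ...], so the connecting map is followed by hand
    ([rees_lc1_nonzero]): injectivity extends [R(I) -> E0] to a graded map
    [g : A[t] -> E0], and the class is that of the image of [g (c t^s)] in
    [E1]. *)

(** * The Ratliff-Rush index and the regularity *)

(** The minimality of the index gives [a] in the closure and [b] in [I^(s-1)]
    with [a b] outside [I^s], where [s] is the index; a factor from [I^n] with
    [n > 0] moves [b] into [I^s] or a higher power, where [a] is no longer
    exceptional. *)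
Lemma rr_index_witness (A : comNzRingType) (hA : noetherian A) (I : set A) :
  (0 < rr_index hA I)%N ->
  exists2 c : A, ~ ideal_pow I (rr_index hA I) c &
    forall n a, (0 < n)%N -> ideal_pow I n a ->
      ideal_pow I (rr_index hA I + n) (a * c).
Proof.
have [] := rr_indexP hA I; case: (rr_index hA I) => [//|s] hs hmin _.
have [a [ha nha]] : exists a, rr_closure I a /\
    ~ colon (ideal_pow I s.+1) (ideal_pow I s) a.
  apply: contrapT => nex; suff /hmin : rr_stable I s by rewrite ltnn.
  move=> n; rewrite leq_eqVlt => /predU1P[<-|/hs //].
  apply/seteqP; split=> a ha.
    exists s.+1 => //; exact: (rr_colon_mono (leqnSn s)).
  by apply: contrapT => nha; apply: nex; exists a.
have [b [hb nab]] : exists b, ideal_pow I s b /\ ~ ideal_pow I s.+1 (a * b).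
  apply: contrapT => nex; apply: nha => b hb.
  by apply: contrapT => nab; apply: nex; exists b.
exists (a * b) => // n z n0 hz.
have ha' : colon (ideal_pow I (s + n).+1) (ideal_pow I (s + n)) a.
  by rewrite hs // -(addn1 s) leq_add2l.
by rewrite mulrCA addSn; apply: ha'; rewrite mulrC; apply: ideal_powD.
Qed.

Lemma reg_ge (R : gradedRing) (i : nat) (n : int) :
  lc_nonzero (self_gmod R) i n -> ((n + i%:Z)%:E <= reg R)%E.
Proof.
move=> hn; have [le_reg _] := ext_supP
  [set (a_inv R i + (i%:Z)%:E)%E | i in [set: nat]].
apply: le_trans (le_reg _ (ex_intro2 _ _ i I erefl)).
rewrite EFinD leeD2r //.
have [le_a _] := ext_supP [set n%:E | n in [set n | lc_nonzero (self_gmod R) i n]].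
by apply: le_a; exists n.
Qed.

(** * The polynomial ring as a graded module over the Rees algebra *)

(** The Rees algebra sits in [A[t]] as the inclusion of a subtype, so the
    [R(I)]-module structure of [A[t]] needs a carrier that records [I]. *)
Definition poly_mod (A : comNzRingType) (I : set A) : Type := {poly A}.

Section PolyModule.
Variables (A : comNzRingType) (I : set A).

HB.instance Definition _ := GRing.Zmodule.on (poly_mod I).

Definition poly_scale (r : rees I) (p : poly_mod I) : poly_mod I :=
  val r * (p : {poly A}).

Lemma poly_scaleA (r r' : rees I) p :
  poly_scale r (poly_scale r' p) = poly_scale (r * r') p.
Proof. by rewrite /poly_scale rmorphM mulrA. Qed.

Lemma poly_scale1 : left_id 1 poly_scale.
Proof. by move=> p; rewrite /poly_scale rmorph1 mul1r. Qed.

Lemma poly_scaleDr : right_distributive poly_scale +%R.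
Proof. by move=> r p q; rewrite /poly_scale mulrDr. Qed.

Lemma poly_scaleDl p : {morph poly_scale^~ p : r r' / r + r'}.
Proof. by move=> r r'; rewrite /poly_scale rmorphD mulrDl. Qed.

HB.instance Definition _ := GRing.Zmodule_isLmodule.Build (rees I)
  (poly_mod I) poly_scaleA poly_scale1 poly_scaleDr poly_scaleDl.

Definition poly_comp (n : int) : set (poly_mod I) :=
  [set p | forall i : nat, i%:Z != n -> (p : {poly A})`_i = 0].

Lemma poly_subgroup n : add_subgroup (poly_comp n).
Proof.
split=> [i _|x y hx hy i ni]; first by rewrite coef0.
by rewrite coefB hx // hy // subr0.
Qed.

Lemma poly_comp_scale (i : nat) (j : int) (r : rees I) (p : poly_mod I) :
  rees_comp i r -> poly_comp j p -> poly_comp (i%:Z + j) (r *: p).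
Proof.
move=> hr hp k kij; rewrite [LHS]coefM big1 // => l _.
have [li|/hr ->] := eqVneq (l : nat) i; last by rewrite mul0r.
rewrite hp ?mulr0 //; apply: contraNneq kij => <-.
by rewrite -li -PoszD subnKC // -ltnS.
Qed.

Lemma poly_direct : internal_direct_sum poly_comp.
Proof.
split.
- move=> p.
  exists [seq Posz k | k <- iota 0 (size (p : {poly A}))].
  exists (fun n : int => if n is Posz k then (p : {poly A})`_k *: 'X^k else 0).
  split.
  + by rewrite map_inj_uniq ?iota_uniq // => a b [].
  + case=> n i ni; last by rewrite coef0.
    by rewrite coefZ coefXn -eqz_nat (negPf ni) mulr0.
  + rewrite big_map -[LHS](coefK (p : {poly A})) poly_def.
    have := big_mkord xpredT (fun i => (p : {poly A})`_i *: 'X^i)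
      (n := size (p : {poly A})).
    by rewrite /index_iota subn0 => ->.
- move=> s f us hf s0 i is_; apply/polyP => k; rewrite coef0.
  have [ki|/hf //] := eqVneq k%:Z i.
  have fk0 j : j != i -> (f j : {poly A})`_k = 0.
    by move=> ji; apply: hf; rewrite ki eq_sym.
  have sumk : \sum_(j <- s) (f j : {poly A})`_k = 0.
    rewrite -(coef_sum s xpredT (fun j => f j : {poly A}) k).
    exact: etrans (congr1 (fun p : {poly A} => p`_k) s0) (coef0 A k).
  by rewrite (bigD1_seq i) //= big1 // addr0 in sumk.
Qed.

Definition poly_gmod : gradedModule (rees_algebra I) :=
  @GradedModule (rees_algebra I) (poly_mod I) poly_comp poly_subgroup
    poly_comp_scale poly_direct.

Definition rees_incl_fun (r : self_gmod (rees_algebra I)) : poly_gmod :=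
  val (r : rees I).

Lemma rees_incl_linear : linear rees_incl_fun.
Proof.
move=> a x y; rewrite /rees_incl_fun.
by rewrite [LHS]rmorphD [X in X + _]rmorphM.
Qed.

HB.instance Definition _ := GRing.isLinear.Build (rees_algebra I)
  (self_gmod (rees_algebra I)) poly_gmod *:%R rees_incl_fun rees_incl_linear.

Lemma rees_incl_comp n x :
  gm_comp n x -> gm_comp (g := poly_gmod) n (rees_incl_fun x).
Proof.
case: n => n hx i ni; first by apply: hx; rewrite -eqz_nat.
by rewrite hx /rees_incl_fun raddf0 coef0.
Qed.

Definition rees_incl : gradedHom (self_gmod (rees_algebra I)) poly_gmod :=
  @GradedHom _ _ _ rees_incl_fun rees_incl_comp.

Lemma rees_incl_inj : injective rees_incl.
Proof. exact: val_inj. Qed.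

End PolyModule.

Lemma poly_scaleE (A : comNzRingType) (I : set A) (r : rees_algebra I)
    (p : poly_gmod I) :
  r *: p = val (r : rees I) * (p : {poly A}) :> {poly A}.
Proof. by []. Qed.

Lemma rees_inclM (A : comNzRingType) (I : set A) (r u : rees_algebra I) :
  rees_incl I (r * u) = r *: rees_incl I u.
Proof. exact: (rmorphM (val : rees I -> {poly A})). Qed.

Lemma lreg_scale_exp_eq0 (A : comNzRingType) (I : set A) (r : rees_algebra I)
    (p : poly_gmod I) k :
  GRing.lreg (val (r : rees I)) -> r ^+ k *: p = 0 -> p = 0.
Proof.
move=> rreg; rewrite poly_scaleE [val _](rmorphXn (val : rees I -> {poly A})).
have := @lregX _ _ k rreg (p : {poly A}) 0; rewrite mulr0 => inj_rk rp0.
exact: inj_rk rp0.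
Qed.

Lemma monomial_rees (A : comNzRingType) (I : set A) n a :
  ideal_pow I n a -> a *: 'X^n \in rees_pred I.
Proof.
move=> ha; apply/rees_predP => k; rewrite coefZ coefXn.
have [->|_] := eqVneq k n; first by rewrite mulr1.
by rewrite mulr0; case: (ideal_pow_ideal I k).
Qed.

Lemma rees_comp_monomial (A : comNzRingType) (I : set A) n (r : rees I) :
  rees_comp n r -> val r = (val r)`_n *: 'X^n.
Proof.
move=> hr; apply/polyP => k; rewrite coefZ coefXn.
by have [->|/hr ->] := eqVneq k n; rewrite ?mulr1 ?mulr0.
Qed.

(** * A nonzero class in the first local cohomology *)

Lemma ideal_pow_exp (A : comNzRingType) (I : set A) k x :
  I x -> ideal_pow I k (x ^+ k).
Proof.
move=> Ix; elim: k => [|k IH] //=.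
by rewrite exprS; apply: ideal_mul_mem.
Qed.

Lemma lreg_scaleX (A : comNzRingType) (x : A) :
  GRing.lreg x -> GRing.lreg (x *: 'X : {poly A}).
Proof.
move=> xreg p q; rewrite -!scalerAl => /polyP pq; apply/polyP => i.
by have := pq i.+1; rewrite !coefZ !coefXM /= => /xreg.
Qed.

Lemma irrelevant_ideal_homog (R : gradedRing) n (r : R) :
  (0 < n)%N -> gr_comp n r -> irrelevant_ideal r.
Proof. by move=> n0 hr; rewrite -[r]mul1r; apply: ideal_mul_mem => //; exists n. Qed.

(** The annihilator of [y] is an ideal, so [y] is killed by [R_+] as soon as it
    is killed by the homogeneous elements that generate it. *)
Lemma annihilated_torsion (R : gradedRing) (M : gradedModule R) (y : M) :
  (forall n (r : R), (0 < n)%N -> gr_comp n r -> r *: y = 0) -> torsion y.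
Proof.
move=> hy; exists 1%N => r.
have annI : is_ideal [set r : R | r *: y = 0].
  split=> [|a b ha hb|a b hb] /=; first exact: scale0r.
    by rewrite scalerDl ha hb addr0.
  by rewrite -scalerA hb scaler0.
move=> hr; have [_ _ annM] := annI.
apply: (ideal_mul_sub annI _ hr) => a b ha _ /=.
rewrite mulrC; apply: (annM); apply: (ideal_mul_sub annI _ ha) => c d _ [n n0 hd].
by apply: annM; apply: hy hd.
Qed.

(** The hypotheses say that [c t^s] lies outside [R(I)] and is multiplied into
    [R(I)] by [R_+].  With [z = c t^s] and [g : A[t] -> E0] extending the
    augmentation, [d0 (g z)] is killed by [R_+], since [g] maps [R_+ z] into
    the kernel of [d0].  If it were [d0 y'] for a torsion element [y'], then
    [g z - y'] would come from some [u] in [R(I)], and [g (z - u) = y'] would be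
    killed by a power of [x t].  But [g] is injective on [R(I)], which contains
    [x t (z - u)], and [x t] is a nonzerodivisor on [A[t]]: so [z = u] would lie
    in [R(I)]. *)
Lemma rees_lc1_nonzero (A : comNzRingType) (I : set A) (s : nat) (c : A) :
  regular_ideal I -> ~ ideal_pow I s c ->
  (forall n a, (0 < n)%N -> ideal_pow I n a -> ideal_pow I (s + n) (a * c)) ->
  lc_nonzero (self_gmod (rees_algebra I)) 1 s.
Proof.
move=> [x Ix xreg] nc hc E hE.
have [g hg] := res_injective (res_aug E) (@rees_incl_inj A I).
pose z : poly_gmod I := c *: 'X^s : {poly A}.
have zcomp : gm_comp s z.
  by move=> i; rewrite eqz_nat => /negPf is_; rewrite coefZ coefXn is_ mulr0.
have mul_z n (r : rees_algebra I) : (0 < n)%N -> gr_comp n r ->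
    exists w, r *: z = rees_incl I w.
  move=> n0 hr.
  have rz : ((val (r : rees I))`_n * c) *: 'X^(n + s) \in rees_pred I.
    apply: monomial_rees; rewrite addnC; apply: hc => //.
    exact/rees_predP/valP.
  exists (exist [in rees_pred I] _ rz : rees I).
  rewrite poly_scaleE [in LHS](rees_comp_monomial hr) -scalerAl -scalerAr.
  by rewrite scalerA -exprD.
have [y' [_ [k hk] dz]] : lc_coboundary E 1 s (res_d E 0%N (g z)).
  apply: hE; split; first exact/gh_comp/gh_comp.
    apply: annihilated_torsion => n r n0 hr; rewrite -!linearZ.
    have [w ->] := mul_z n r n0 hr.
    by rewrite hg; apply/res_exact0; exists w.
  by apply/res_exact; exists (g z).
have /res_exact0[u hu] : res_d E 0%N (g z - y') = 0 by rewrite linearB dz subrr.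
have xt : x *: 'X \in rees_pred I.
  by rewrite -['X]expr1; apply: monomial_rees; rewrite -[x]expr1; apply: ideal_pow_exp.
(* [T] is the element [x t] of [R_+]. *)
pose T : rees_algebra I := exist [in rees_pred I] _ xt : rees I.
have Tcomp : gr_comp 1 T.
  by move=> i /negPf i1; rewrite /= coefZ coefX i1 mulr0.
have Tregk j (p : poly_gmod I) : T ^+ j *: p = 0 -> p = 0.
  exact/lreg_scale_exp_eq0/lreg_scaleX.
have zu : z = rees_incl I u.
  (* The exponent is [k + 1] as [z - u] itself may lie outside [R(I)], where
     [g] need not be injective, while [T * (z - u)] lies in it. *)
  have [w hw] := mul_z 1%N T isT Tcomp.
  apply/eqP; rewrite -subr_eq0; apply/eqP/(Tregk k.+1).
  have gzu : g (z - rees_incl I u) = y'.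
    by rewrite linearB hg -hu opprB addrC subrK.
  have hTk : T ^+ k *: y' = 0.
    apply: hk; apply: ideal_pow_exp.
    exact: irrelevant_ideal_homog Tcomp.
  have Tzu : T ^+ k.+1 *: (z - rees_incl I u) =
      rees_incl I (T ^+ k * (w - T * u)).
    rewrite exprSr -scalerA scalerBr hw.
    by rewrite rees_inclM [rees_incl I (_ - _)]linearB rees_inclM.
  have : res_aug E (T ^+ k * (w - T * u)) = 0.
    by rewrite -hg -Tzu linearZZ gzu exprS -scalerA hTk scaler0.
  by rewrite -(linear0 (res_aug E)) => /res_aug_inj h; rewrite Tzu h linear0.
apply: nc; have /rees_predP := valP (u : rees I).
move=> /(_ s); rewrite -[val _]/(rees_incl I u) -zu.
by rewrite coefZ coefXn eqxx mulr1.
Qed.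

Unset Implicit Arguments.

Theorem theorem1p7 (A : comNzRingType) (m : set A)
    (A_noetherian : noetherian A) (A_local : local_ring m)
    (A_dim : (0 < krull_dim A)%E)
    (I : set A) (I_ideal : is_ideal I) (I_regular : regular_ideal I) :
  ((rr_index A_noetherian I)%:Z%:E <= maxe (reg (rees_algebra I) - 1) 0)%E.
Proof.
rewrite le_max; have [s0|s_gt0] := posnP (rr_index A_noetherian I).
  by rewrite s0 lexx orbT.
have [c nc hc] := rr_index_witness s_gt0.
have := reg_ge (rees_lc1_nonzero I_regular nc hc).
by rewrite leeBrDr // -EFinD => ->.
Qed.
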